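(* Let $f$ be a field of characteristic $p>0$ and $F=f((t))$. The function $w:F\to\mathbb{Z}$ (the width) defined by $$w(h)=\max\left\{\left[\frac{\mathrm{ord}_{\mathrm{md}}(h)-m}{|m|_p^{-1}-|\mathrm{ord}_{\mathrm{md}}(h)|_p^{-1}}\right]\ :\ x_m(h)\ne0,\ 0\ne m<\mathrm{ord}_{\mathrm{md}}(h)\right\}$$ if $\mathrm{ord}_{\mathrm{md}}(h)>\mathrm{ord}_0(h)$, and $w(h)=0$ otherwise, is $G_0$-invariant.
   Context: $G_0$ is the group of automorphisms of the field $F=f((t))$ fixing $f$ pointwise; its elements are determined by $g(t)=ct+o(t)$, $c\in f$, $c\ne0$, where $o(t)$ denotes a series with all terms of degree $>1$. Write $h=\sum_{i\ge\mathrm{ord}\,h}x_i(h)t^i$ with $x_i(h)\in f$, where $\mathrm{ord}$ is the $t$-adic order ($\mathrm{ord}\,0=\infty$). Define $\mathrm{ord}_0(h)=\mathrm{ord}(h-x_0(h))$, $\mathrm{md}(h)=\max\{m\in\mathbb{Z}: h\in f((t^{p^m}))\}$, $\mathrm{ord}_{\mathrm{md}}(h)=\max\{\mathrm{ord}(h-a): a\in f((t^{p^{\mathrm{md}(h)+1}}))\}$. For a constant $h\in f$, $\mathrm{ord}_0(h)=\mathrm{md}(h)=\mathrm{ord}_{\mathrm{md}}(h)=\infty$, so $w(h)=0$. For a nonzero integer $m$, $|m|_p^{-1}=\max\{p^d: d\in\mathbb{Z},\ m/p^d\in\mathbb{Z}\}$. $[\cdot]$ is the integer part. *)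

(* Defs.v *)
From HB Require Import structures.
From mathcomp Require Import all_boot all_order all_algebra.
From mathcomp Require Import boolp classical_sets functions cardinality fsbigop.
From mathcomp Require Import constructive_ereal.
From mathcomp Require Import zify.

Set Implicit Arguments.
Unset Strict Implicit.
Unset Printing Implicit Defensive.

Import Order.TTheory GRing.Theory Num.Theory.
Local Open Scope classical_set_scope.
Local Open Scope ring_scope.

Definition bounded_below (R : nmodType) (x : int -> R) :=
  exists N : int, forall i : int, i < N -> x i = 0.

Record laurent (R : nmodType) := Laurent {
  lcoef :> int -> R;
  lcoef_bounded : bounded_below lcoef
}.

Notation "{ 'laurent' R }" := (laurent R)
  (at level 0, R at level 2, format "{ 'laurent'  R }") : type_scope.

HB.instance Definition _ (R : nmodType) := gen_eqMixin {laurent R}.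
HB.instance Definition _ (R : nmodType) := gen_choiceMixin {laurent R}.

Lemma laurentP (R : nmodType) (x y : {laurent R}) :
  (forall i, x i = y i) <-> x = y.
Proof.
split=> [|-> //]; case: x y => [x hx] [y hy] /= /funext exy.
by move: hx hy; rewrite exy => hx hy; congr Laurent; exact: Prop_irrelevance.
Qed.

Section LaurentZmod.
Variable R : zmodType.
Implicit Types x y z : {laurent R}.

Lemma lzero_bounded : bounded_below (fun _ : int => 0 : R).
Proof. by exists 0. Qed.

Lemma lopp_bounded x : bounded_below (fun i => - x i).
Proof. by have [N hN] := lcoef_bounded x; exists N => i /hN ->; rewrite oppr0. Qed.

Lemma ladd_bounded x y : bounded_below (fun i => x i + y i).
Proof.
have [N hN] := lcoef_bounded x; have [M hM] := lcoef_bounded y.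
by exists (Num.min N M) => i; rewrite lt_min => /andP[/hN -> /hM ->]; rewrite addr0.
Qed.

Definition lzero := Laurent lzero_bounded.
Definition lopp x := Laurent (lopp_bounded x).
Definition ladd x y := Laurent (ladd_bounded x y).

Lemma laddA : associative ladd.
Proof. by move=> x y z; apply/laurentP => i /=; rewrite addrA. Qed.
Lemma laddC : commutative ladd.
Proof. by move=> x y; apply/laurentP => i /=; rewrite addrC. Qed.
Lemma ladd0 : left_id lzero ladd.
Proof. by move=> x; apply/laurentP => i /=; rewrite add0r. Qed.
Lemma laddN : left_inverse lzero lopp ladd.
Proof. by move=> x; apply/laurentP => i /=; rewrite addNr. Qed.

HB.instance Definition _ :=
  GRing.isZmodule.Build {laurent R} laddA laddC ladd0 laddN.

Lemma lcoef0 i : (0 : {laurent R}) i = 0. Proof. by []. Qed.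
Lemma lcoefD x y i : (x + y) i = x i + y i. Proof. by []. Qed.
Lemma lcoefN x i : (- x) i = - x i. Proof. by []. Qed.
Lemma lcoefB x y i : (x - y) i = x i - y i. Proof. by []. Qed.

Lemma lconst_bounded (c : R) : bounded_below (fun i => if i == 0 then c else 0).
Proof. by exists 0 => i; case: eqVneq => // ->. Qed.

Definition lconst (c : R) : {laurent R} := Laurent (lconst_bounded c).

End LaurentZmod.

Notation "c %:L" := (lconst c) (format "c %:L")
  : ring_scope.

Section LaurentRing.
Variable R : comNzRingType.
Implicit Types x y z : {laurent R}.

(* The sum is over all of int, with finite support for fixed n. *)
Definition lmul_coef (x y : int -> R) (n : int) : R :=
  \sum_(i \in [set: int]) x i * y (n - i).

Definition supp_ge (N : int) (x : int -> R) := forall i, i < N -> x i = 0.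

Lemma lmul_coefE (x y : int -> R) (a b : int) (K : nat) :
    supp_ge a x -> supp_ge b y ->
  lmul_coef x y (a + b + K%:Z) = \sum_(k < K.+1) x (a + k%:Z) * y (b + (K - k)%:Z).
Proof.
move=> ha hb; pose r := [seq a + k%:Z | k <- iota 0 K.+1].
rewrite /lmul_coef -(@fsbig_widen _ _ _ _ [set` r]) //; last first.
  move=> i [_ /= nri]; have [ia|ai] := ltP i a; first by rewrite ha ?mul0r.
  rewrite [X in _ * X]hb ?mulr0 // ltNge; apply/negP => le.
  apply: nri; apply/mapP; exists (`|i - a|%N); last lia.
  by rewrite mem_iota; lia.
rewrite -fsbig_seq; last first.
  by rewrite map_inj_uniq ?iota_uniq // => k l; lia.
rewrite big_map -[iota _ _]/(index_iota 0 K.+1) big_mkord; apply: eq_bigr => k _.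
by congr (_ * y _); have := ltn_ord k; lia.
Qed.

Lemma lmul_coef_lt (x y : int -> R) (a b : int) :
  supp_ge a x -> supp_ge b y -> supp_ge (a + b) (lmul_coef x y).
Proof.
move=> ha hb n ltn; apply: fsbig1 => i _.
have [ia|ai] := ltP i a; first by rewrite ha ?mul0r.
by rewrite [X in _ * X]hb ?mulr0 //; lia.
Qed.

Lemma lmul_bounded x y : bounded_below (lmul_coef x y).
Proof.
have [a ha] := lcoef_bounded x; have [b hb] := lcoef_bounded y.
by exists (a + b); apply: lmul_coef_lt.
Qed.

Definition lmul x y := Laurent (lmul_bounded x y).

Let tr (K : nat) (x : int -> R) (a : int) : {poly R} :=
  \poly_(i < K.+1) x (a + i%:Z).

Lemma lmul_coef_poly (x y : int -> R) (a b : int) (K L : nat) :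
    supp_ge a x -> supp_ge b y -> (K <= L)%N ->
  lmul_coef x y (a + b + K%:Z) = (tr L x a * tr L y b)`_K.
Proof.
move=> ha hb leKL; rewrite (lmul_coefE _ ha hb) coefM; apply: eq_bigr => k _.
have := ltn_ord k => ltk; rewrite !coef_poly ifT; last by lia.
by rewrite ifT //; lia.
Qed.

Lemma laurent_eq_ge x y (a : int) : supp_ge a x -> supp_ge a y ->
  (forall K : nat, x (a + K%:Z) = y (a + K%:Z)) -> x = y.
Proof.
move=> hx hy exy; apply/laurentP => i; have [ia|ai] := ltP i a.
  by rewrite hx ?hy.
by have -> : i = a + `|i - a|%N%:Z by lia.
Qed.

Lemma lmulC : commutative lmul.
Proof.
move=> x y; have [a ha] := lcoef_bounded x; have [b hb] := lcoef_bounded y.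
apply: (@laurent_eq_ge _ _ (a + b)) => [||K] /=; first exact: lmul_coef_lt.
  by rewrite addrC; exact: lmul_coef_lt.
by rewrite (@lmul_coef_poly _ _ _ _ _ K) // addrC (addrC a) addrC
  (@lmul_coef_poly _ _ _ _ _ K) // mulrC.
Qed.

Lemma coefMl_eq (P P' Q : {poly R}) (K : nat) :
  (forall i, (i <= K)%N -> P`_i = P'`_i) -> (P * Q)`_K = (P' * Q)`_K.
Proof.
by move=> e; rewrite !coefM; apply: eq_bigr => i _; rewrite e // -ltnS.
Qed.

Lemma lmulA : associative lmul.
Proof.
move=> x y z; have [a ha] := lcoef_bounded x; have [b hb] := lcoef_bounded y.
have [c hc] := lcoef_bounded z.
have hab := lmul_coef_lt ha hb; have hbc := lmul_coef_lt hb hc.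
apply: (@laurent_eq_ge _ _ (a + (b + c))) => [||K] /=; first exact: lmul_coef_lt.
  by rewrite addrA; exact: lmul_coef_lt.
rewrite (lmul_coef_poly ha hbc (leqnn K)) addrA (lmul_coef_poly hab hc (leqnn K)).
rewrite mulrC (@coefMl_eq (tr K _ (b + c)) (tr K y b * tr K z c)) => [|i le]; last first.
  by rewrite coef_poly ltnS le /= (lmul_coef_poly hb hc le).
rewrite (@coefMl_eq (tr K _ (a + b)) (tr K x a * tr K y b)) => [|i le]; last first.
  by rewrite coef_poly ltnS le /= (lmul_coef_poly ha hb le).
by rewrite mulrC mulrA.
Qed.

Lemma lmulDl : left_distributive lmul (@ladd R).
Proof.
move=> x y z; have [a ha] := lcoef_bounded x; have [b hb] := lcoef_bounded y.
have [c hc] := lcoef_bounded z; pose m := Num.min a b.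
have hx : supp_ge m x by move=> i; rewrite lt_min => /andP[/ha].
have hy : supp_ge m y by move=> i; rewrite lt_min => /andP[_ /hb].
have hxy : supp_ge m (ladd x y) by move=> i im /=; rewrite hx ?hy ?addr0.
apply: (@laurent_eq_ge _ _ (m + c)) => [||K]; first exact: lmul_coef_lt.
  by move=> i im /=; rewrite (lmul_coef_lt hx hc) ?(lmul_coef_lt hy hc) ?addr0.
rewrite /= !(@lmul_coefE _ _ m c) // -big_split /=.
by apply: eq_bigr => k _; rewrite mulrDl.
Qed.

Lemma lmul1 : left_id 1%:L lmul.
Proof.
move=> x; have [a ha] := lcoef_bounded x.
have h1 : supp_ge 0 (1%:L : {laurent R}) by move=> i /=; case: eqVneq => // ->.
apply: (@laurent_eq_ge _ _ (0 + a)) => [||K]; first exact: lmul_coef_lt.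
  by rewrite add0r.
rewrite /= (lmul_coefE _ h1 ha) big_ord_recl /= big1 => [|k _]; last first.
  by rewrite mul0r.
by rewrite addr0 mul1r subn0 add0r.
Qed.

Lemma lone_neq0 : 1%:L != 0 :> {laurent R}.
Proof.
by apply/eqP => /laurentP/(_ 0) /= /eqP; rewrite oner_eq0.
Qed.

HB.instance Definition _ := GRing.Zmodule_isComNzRing.Build {laurent R}
  lmulA lmulC lmul1 lmulDl lone_neq0.

Lemma lcoefM x y n : (x * y) n = \sum_(i \in [set: int]) x i * y (n - i).
Proof. by []. Qed.

Lemma lcoef1 i : (1 : {laurent R}) i = (i == 0)%:R.
Proof. by rewrite -[1]/(1%:L) /=; case: eqP. Qed.

End LaurentRing.

Section LaurentField.
Variable f : fieldType.
Implicit Types x y : {laurent f}.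

Lemma laurent_ex_ord x : x != 0 ->
  exists2 n : int, x n != 0 & forall i, i < n -> x i = 0.
Proof.
move=> x0; have [N hN] := lcoef_bounded x.
have exk : exists k : nat, x (N + k%:Z) != 0.
  apply: contrapT => nex; move/eqP: x0; apply; apply/laurentP => i /=.
  have [/hN //|Ni] := ltP i N; apply/eqP/negPn/negP => xi; apply: nex.
  by exists `|i - N|%N; have <- : i = N + `|i - N|%N%:Z by lia.
case: (ex_minnP exk) => k xk mink; exists (N + k%:Z) => // i ik.
have [/hN //|Ni] := ltP i N; apply/eqP/negPn/negP => xi.
suff : (k <= `|i - N|)%N by lia.
by apply: mink; have <- : i = N + `|i - N|%N%:Z by lia.
Qed.

(* [:: y_n; ...; y_0], coefficients of the inverse of \sum_i X i t^i. *)
Fixpoint inv_coefs (X : nat -> f) (n : nat) : seq f :=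
  match n with
  | 0 => [:: (X 0)^-1]
  | n.+1 => let s := inv_coefs X n in
     - (X 0)^-1 * (\sum_(k < n.+1) X k.+1 * s`_k) :: s
  end.

Lemma inv_coefs_nth X n k : (k <= n)%N -> (inv_coefs X n)`_k = (inv_coefs X (n - k))`_0.
Proof.
by elim: n k => [|n IH] [|k] //= le; rewrite IH.
Qed.

Lemma inv_coefsP X : X 0%N != 0 -> forall K : nat,
  \sum_(k < K.+1) X k * (inv_coefs X (K - k))`_0 = (K == 0%N)%:R.
Proof.
move=> X0 [|K]; first by rewrite big_ord_recl big_ord0 /= addr0 mulfV.
rewrite big_ord_recl /= mulNr mulrN mulrA mulfV // mul1r addrC.
apply/eqP; rewrite subr_eq0; apply/eqP/eq_bigr => k _ /=.
by rewrite (@inv_coefs_nth _ _ k) ?subSS // -ltnS.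
Qed.

Lemma laurent_ex_inv x : x != 0 -> exists y, y * x = 1.
Proof.
move=> /laurent_ex_ord[n xn hn]; pose X k := x (n + k%:Z).
pose c (i : int) : f := if i < - n then 0 else (inv_coefs X `|(i + n)%R|%N)`_0.
have hc : supp_ge (- n) c by move=> i lt; rewrite /c lt.
have bc : bounded_below c by exists (- n).
exists (Laurent bc); rewrite mulrC; apply: (@laurent_eq_ge _ _ _ 0) => [||K].
- by have := lmul_coef_lt hn hc; rewrite subrr.
- by move=> i lt; rewrite lcoef1; case: eqP lt => // ->.
rewrite lcoef1 -{1}(subrr n) [LHS](lmul_coefE K hn hc) add0r.
rewrite -[RHS](@inv_coefsP X) /X ?addr0 //; apply: eq_bigr => k _.
by rewrite /c ifF; [congr (_ * (inv_coefs _ _)`_0)|]; lia.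
Qed.

Definition linv x : {laurent f} := xget 0 [set y | y * x = 1].

Lemma lmulVf x : x != 0 -> linv x * x = 1.
Proof. by move=> /laurent_ex_inv ex; exact: (@xgetPex _ 0 [set y | y * x = 1]). Qed.

Lemma linv0 : linv 0 = 0.
Proof.
rewrite /linv; case: xgetP => // y _ /= /eqP.
by rewrite mulr0 eq_sym oner_eq0.
Qed.

HB.instance Definition _ := GRing.ComNzRing_isField.Build {laurent f} lmulVf linv0.

End LaurentField.

(* All field automorphisms over f, with no continuity assumption. *)
Definition G0 (f : fieldType) : set {rmorphism {laurent f} -> {laurent f}} :=
  [set g : {rmorphism _ -> _} | bijective g /\ forall c : f, g c%:L = c%:L].

Arguments G0 f : clear implicits.

(* [dflt] is the value when the extremum is not attained. *)
Definition maximum d (T : porderType d) (dflt : T) (S : set T) : T :=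
  xget dflt (S `&` ubound S).

Definition minimum d (T : porderType d) (dflt : T) (S : set T) : T :=
  xget dflt (S `&` lbound S).

Section Width.
Variables (f : fieldType) (p : nat).
Implicit Types (h a : {laurent f}) (m n : int).

(* The minimum is not attained exactly for h = 0, where the value is +oo. *)
Definition ord h : \bar int := minimum +oo%E [set i%:E | i in [set i | h i != 0]].

Definition ord_0 h : \bar int := ord (h - (h 0)%:L).

(* Elements of f((t)) lying in f((t^q)), with q = p^m and m in Z: all exponents
   are integer multiples of the rational number p^m. *)
Definition in_laurent_pow m h : Prop :=
  forall i, h i != 0 -> i%:Q / p%:Q ^ m \is a Num.int.

(* For constant h the set is all of Z, which has no maximum, and md h = +oo. *)
Definition md h : \bar int :=
  maximum +oo%E [set m%:E | m in [set m | in_laurent_pow m h]].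

Definition ord_md h : \bar int :=
  if md h is d%:E
  then maximum +oo%E [set ord (h - a) | a in [set a | in_laurent_pow (d + 1) a]]
  else +oo%E.

(* |m|_p^{-1} for m <> 0; the set has no maximum for m = 0. *)
Definition padic_abs_inv m : rat :=
  maximum 0 [set p%:Q ^ d | d in [set d : int | m%:Q / p%:Q ^ d \is a Num.int]].

Definition width h : int :=
  if (ord_0 h < ord_md h)%E then
    let n := fine (ord_md h) in
    maximum 0
      [set Num.floor ((n - m)%:Q / (padic_abs_inv m - padic_abs_inv n))
         | m in [set m | [/\ h m != 0, m != 0 & m < n]]]
  else 0.

End Width.

(* Off the stated exceptions, all the extrema used above are attained, so that
   the default values play no role. *)

Lemma maximumP d (T : porderType d) (dflt : T) (S : set T) (x : T) :
  S x -> ubound S x -> maximum dflt S = x.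
Proof.
move=> Sx ubx; rewrite /maximum; case: xgetP => [y _ [Sy uby]|/(_ x)]; last by case.
by apply/le_anti; rewrite ubx // uby.
Qed.

Lemma minimumP d (T : porderType d) (dflt : T) (S : set T) (x : T) :
  S x -> lbound S x -> minimum dflt S = x.
Proof.
move=> Sx lbx; rewrite /minimum; case: xgetP => [y _ [Sy lby]|/(_ x)]; last by case.
by apply/le_anti; rewrite lbx // lby.
Qed.

Section Attained.
Variables (f : fieldType) (p : nat).
Hypothesis p_prime : prime p.
Implicit Types (h a : {laurent f}) (m n : int).

Lemma ordP h n : h n != 0 -> (forall i, i < n -> h i = 0) -> ord h = n%:E.
Proof.
move=> hn lt0; apply: minimumP => [|_ [i /= hi <-]]; first by exists n.
by rewrite lee_fin leNgt; apply/negP => /lt0 e; rewrite e eqxx in hi.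
Qed.

Lemma ordr0 : ord (0 : {laurent f}) = +oo%E.
Proof.
by rewrite /ord /minimum; case: xgetP => // x _ [[i /=]]; rewrite eqxx.
Qed.

Lemma ord_le h n : h n != 0 -> (ord h <= n%:E)%E.
Proof.
move=> hn; have h0 : h != 0 by apply: contraNneq hn => ->.
have [m hm ltm] := laurent_ex_ord h0; rewrite (ordP hm ltm) lee_fin leNgt.
by apply/negP => /ltm e; rewrite e eqxx in hn.
Qed.

Lemma int_div_expN m (k : nat) : m%:Q / p%:Q ^ (- k%:Z) \is a Num.int.
Proof. by rewrite -exprnN invrK rpredM ?rpredX ?rpred_int. Qed.

Lemma pexpE (k : nat) : p%:Q ^ k%:Z = (p ^ k)%N%:Q.
Proof. by rewrite -exprnP -!pmulrn natrX. Qed.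

Lemma int_div_exp m (k : nat) :
  (m%:Q / p%:Q ^ k%:Z \is a Num.int) = (p ^ k %| `|m|)%N.
Proof.
have pk0 : (p ^ k)%N%:Q != 0.
  by rewrite intr_eq0 -lt0n expn_gt0 prime_gt0.
rewrite pexpE.
rewrite -[(_ %| _)%N]/((p ^ k)%N%:Z %| m)%Z; apply/idP/idP => [/intrP[z e]|].
  apply/dvdzP; exists z; apply: (@intr_inj rat); rewrite rmorphM /= -e.
  by rewrite divfK.
exact: Qint_dvdz.
Qed.

Lemma padic_abs_invE m : m != 0 -> padic_abs_inv p m = (p ^ logn p `|m|)%N%:Q.
Proof.
move=> m0; have am0 : (0 < `|m|)%N by rewrite absz_gt0.
apply: maximumP => [|_ [d /= dm <-]].
  by exists (logn p `|m|)%:Z; rewrite /= ?int_div_exp ?pfactor_dvdnn ?pexpE.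
rewrite -pexpE ler_weXz2l ?ler1n ?prime_gt0 //; case: d dm => d // dm.
by rewrite lez_nat -pfactor_dvdn // -int_div_exp.
Qed.

Lemma md_const (c : f) : md p c%:L = +oo%E.
Proof.
rewrite /md /maximum; case: xgetP => // x _ [[d _ <-]] /(_ (d + 1)%:E) ub.
suff: ((d + 1)%:E <= d%:E)%E by rewrite lee_fin; lia.
apply: ub; exists (d + 1) => // i /=; case: (eqVneq i 0) => [->|]; last by rewrite eqxx.
by rewrite mul0r.
Qed.

Lemma width_const (c : f) : width p c%:L = 0.
Proof. by rewrite /width /ord_md md_const /ord_0 /= subrr ordr0 ltxx. Qed.

Lemma nonconstP h : (forall c : f, h <> c%:L) -> exists2 i, i != 0 & h i != 0.
Proof.
move=> hc; apply: contrapT => nex; apply: (hc (h 0)); apply/laurentP => i /=.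
case: eqVneq => [-> //|i0]; apply/eqP/negPn/negP => hi; apply: nex.
by exists i.
Qed.

Lemma in_laurent_powE (d : nat) h :
  in_laurent_pow p d h <-> forall i, h i != 0 -> (p ^ d %| `|i|)%N.
Proof. by split=> H i /H; rewrite int_div_exp. Qed.

Lemma md_attained h : (forall c : f, h <> c%:L) ->
  exists d : nat, [/\ md p h = d%:Z%:E, in_laurent_pow p d h &
                     forall m, in_laurent_pow p m h -> m <= d].
Proof.
move=> /nonconstP[i i0 hi].
have ai0 : (0 < `|i|)%N by rewrite absz_gt0.
have [||d /asboolP Pd mxd] := @ex_maxnP (fun d => `[< in_laurent_pow p d%:Z h >]) `|i|%N.
- by exists 0%N; apply/asboolP/in_laurent_powE => j _; rewrite expn0 dvd1n.
- move=> d /asboolP/in_laurent_powE/(_ _ hi) /dvdn_leq -/(_ ai0).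
  by apply: leq_trans; apply/ltnW/ltn_expl/prime_gt1.
have mx m : in_laurent_pow p m h -> m <= d.
  by case: m => // m hm; apply: mxd; apply/asboolP.
exists d; split => //; apply: maximumP; first by exists d.
by move=> _ [m /= hm <-]; rewrite lee_fin mx.
Qed.

Lemma ord_md_attained h (d : nat) : md p h = d%:Z%:E -> 
    (forall c : f, h <> c%:L) ->
  exists n, [/\ ord_md p h = n%:E, h n != 0, ~~ (p ^ d.+1 %| `|n|)%N &
    forall i, h i != 0 -> i < n -> (p ^ d.+1 %| `|i|)%N].
Proof.
move=> mdh hc; have [d' [mdh' hd mxd]] := md_attained hc.
have ed : d' = d by move: mdh'; rewrite mdh => -[].
subst d'; pose r i := if (p ^ d.+1 %| `|i|)%N then h i else 0.
have br : bounded_below r.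
  by have [N hN] := lcoef_bounded h; exists N => i /hN; rewrite /r => ->; case: ifP.
pose a := Laurent br.
have ra : in_laurent_pow p (d%:Z + 1) a.
  rewrite -[d%:Z + 1]/(d + 1)%N%:Z addn1; apply/in_laurent_powE => i /=.
  by rewrite /r; case: ifP => // _; rewrite eqxx.
have cE i : (h - a) i = if (p ^ d.+1 %| `|i|)%N then 0 else h i.
  by rewrite lcoefB /= /r; case: ifP; rewrite ?subrr ?subr0.
have ha0 : h - a != 0.
  apply/eqP => e; suff /mxd : in_laurent_pow p (d%:Z + 1) h by lia.
  by move/eqP: e; rewrite subr_eq0 => /eqP ->.
have [n hn ltn] := laurent_ex_ord ha0; exists n.
have nd : ~~ (p ^ d.+1 %| `|n|)%N by move: hn; rewrite cE; case: ifP; rewrite ?eqxx.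
have hn0 : h n != 0 by move: hn; rewrite cE (negbTE nd).
split => // [|i hi /ltn]; last by rewrite cE; case: ifP => // _ e; rewrite e eqxx in hi.
rewrite /ord_md mdh; apply: maximumP; first by exists a => //; exact: ordP.
move=> _ [b /= hb <-]; apply: ord_le; rewrite lcoefB.
suff -> : b n = 0 by rewrite subr0.
apply/eqP/negPn/negP => bn; move: nd; rewrite -[d.+1]addn1.
by move: hb; rewrite -[d%:Z + 1]/(d + 1)%N%:Z => /in_laurent_powE -> .
Qed.

Lemma width_attained h (n : int) : ord_md p h = n%:E -> (ord_0 h < n%:E)%E ->
  exists m, [/\ h m != 0, m != 0, m < n,
    width p h = Num.floor ((n - m)%:Q / (padic_abs_inv p m - padic_abs_inv p n)) &
    forall i, h i != 0 -> i != 0 -> i < n ->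
     Num.floor ((n - i)%:Q / (padic_abs_inv p i - padic_abs_inv p n)) <= width p h].
Proof.
move=> hn lt0; rewrite /width hn lt0 /=; set F := fun m => Num.floor _.
pose P m := [&& h m != 0, m != 0 & m < n].
have [m0 Pm0] : exists m, P m.
  have : h - (h 0)%:L != 0 by apply: contraTneq lt0; rewrite /ord_0 => ->; rewrite ordr0.
  move=> /laurent_ex_ord[m hm ltm]; exists m; move: lt0.
  rewrite /ord_0 (ordP hm ltm) lte_fin /P => ->; rewrite andbT.
  move: hm; rewrite lcoefB /=; case: (eqVneq m 0) => [->|_]; first by rewrite subrr eqxx.
  by rewrite subr0 => ->.
have [N hN] := lcoef_bounded h.
have PN m : P m -> exists k : 'I_(`|n - N|%N), m = N + k%:Z.
  move=> /and3P[hm _ mn]; have Nm : N <= m by rewrite leNgt; apply/negP => /hN e; rewrite e eqxx in hm.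
  have lt : (`|m - N| < `|n - N|)%N by lia.
  by exists (Ordinal lt) => /=; lia.
have [k0 ek0] := PN _ Pm0; rewrite ek0 in Pm0.
case: (@Order.TotalTheory.arg_maxP _ _ _ k0 (fun k : 'I__ => P (N + k%:Z)) (fun k => F (N + k%:Z)) Pm0) => k Pk mxk.
have mx i : P i -> F i <= F (N + k%:Z).
  by move=> Pi; have [j ej] := PN _ Pi; rewrite ej; apply: mxk; rewrite -ej.
have e : maximum 0 [set F m | m in [set m | [/\ h m != 0, m != 0 & m < n]]] = F (N + k%:Z).
  apply: maximumP; first by exists (N + k%:Z) => //; case/and3P: Pk.
  by move=> _ [i /= [h1 h2 h3] <-]; apply: mx; apply/and3P.
exists (N + k%:Z); have [h1 h2 h3] := and3P Pk; split => //.
by move=> i i1 i2 i3; rewrite [leRHS]e; apply: mx; apply/and3P.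
Qed.

End Attained.

(* Main.v *)
Require Import Defs.
From mathcomp Require Import all_boot all_order all_algebra.
From mathcomp Require Import boolp classical_sets.
From HB Require Import structures.
From mathcomp Require Import fsbigop constructive_ereal.
From mathcomp Require Import zify ring.
Import GRing.Theory.
Import Order.TTheory Num.Theory.
Local Open Scope classical_set_scope.
Local Open Scope ring_scope.

(** Let [g] be an automorphism of [F = f((t))] over [f]. The proof has two steps.

    First, the abstract automorphism [g] preserves the order. Every [x] of positive order is of the form [z ^ p - z] with [z] of positive order
    (lemma [artin_schreier]). If [g x] had a negative order, it would be [p] times
    the order of [g z], which is also negative, and an infinite descent would
    start. So [g] maps the maximal ideal into the valuation ring, hence, since [g]
    fixes [f], the valuation ring and its maximal ideal into themselves. The same
    holds for the inverse of [g], and this forces [g t] to have order 1 (lemma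
    [auto_uniformizer]), from which preservation of the order follows (lemmas
    [auto_supp_ge] and [auto_ord]). Hence [g] is continuous, and every exponent of
    [g h] is an exponent of [g (t ^ i)] for some exponent [i] of [h] (lemma
    [additive_support]). As [p ^ d]-th powers are supported on multiples of
    [p ^ d], the map [g] preserves each subfield [f((t ^ (p ^ d)))] (lemma
    [auto_in_pow]). So [ord], [md], [ord_md] and [ord_0] are all invariant.

    Secondly, let [n] be the common value of [ord_md] on [h] and [g h], and let
    [j < n] be a nonzero exponent of [g h] at which its width is attained. It
    is an exponent of [g (t ^ i)] for some exponent [i] of [h]. Then [i <= j], and
    the power of [p] that divides [i] also divides [j]; so passing from [j] to [i]
    does not decrease the numerator of the fraction in the width, and does not
    increase its denominator, which stays positive because [i] is divisible by
    a higher power of [p] than [n]. This gives [width (g h) <= width h] (lemma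
    [auto_width_le]); the inverse of [g] gives the other inequality. *)

Set Implicit Arguments.
Unset Strict Implicit.
Unset Printing Implicit Defensive.

(** * The order filtration and monomials *)

Section Order.
Variable f : fieldType.
Implicit Types (x y : {laurent f}) (i j a b n : int) (c : f).

Lemma supp_ge_le a b x : a <= b -> supp_ge b x -> supp_ge a x.
Proof. by move=> ab hx i ia; apply: hx; lia. Qed.

Lemma supp_geD a x y : supp_ge a x -> supp_ge a y -> supp_ge a (x + y).
Proof. by move=> hx hy i ia; rewrite lcoefD hx ?hy ?addr0. Qed.

Lemma supp_geN a x : supp_ge a x -> supp_ge a (- x).
Proof. by move=> hx i ia; rewrite lcoefN hx ?oppr0. Qed.

Lemma supp_geB a x y : supp_ge a x -> supp_ge a y -> supp_ge a (x - y).
Proof. by move=> hx hy; apply: supp_geD => //; apply: supp_geN. Qed.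

Lemma supp_geS a x : supp_ge a x -> x a = 0 -> supp_ge (a + 1) x.
Proof.
move=> hx xa i ia; have [->//|ne] := eqVneq i a.
by apply: hx; lia.
Qed.

Lemma supp_geM a b x y : supp_ge a x -> supp_ge b y -> supp_ge (a + b) (x * y).
Proof. exact: lmul_coef_lt. Qed.

Lemma supp_ge_const c : supp_ge 0 (c%:L : {laurent f}).
Proof. by move=> i /=; case: eqVneq => // ->. Qed.

Lemma supp_ge_sub_const x : supp_ge 0 x -> supp_ge 1 (x - (x 0)%:L).
Proof.
move=> hx; rewrite -[1]add0r; apply: supp_geS; last by rewrite lcoefB /= subrr.
by apply: supp_geB => //; exact: supp_ge_const.
Qed.

Lemma supp_ge1 : supp_ge 0 (1 : {laurent f}).
Proof. exact: supp_ge_const. Qed.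

Lemma supp_geX a x k : supp_ge a x -> supp_ge (a * k%:Z) (x ^+ k).
Proof.
move=> hx; elim: k => [|k IH]; first by rewrite mulr0 expr0; exact: supp_ge1.
rewrite exprS (_ : a * k.+1%:Z = a + a * k%:Z); first exact: supp_geM.
by rewrite intS mulrDr mulr1.
Qed.

Lemma lead_coefM a b x y : supp_ge a x -> supp_ge b y ->
  (x * y) (a + b) = x a * y b.
Proof.
move=> hx hy; have := lmul_coefE 0 hx hy.
by rewrite big_ord_recl big_ord0 /= !addr0.
Qed.

Lemma lead_coefX a x k : supp_ge a x -> (x ^+ k) (a * k%:Z) = x a ^+ k.
Proof.
move=> hx; elim: k => [|k IH]; first by rewrite mulr0 !expr0 lcoef1.
rewrite !exprS (_ : a * k.+1%:Z = a + a * k%:Z) ?lead_coefM ?IH //.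
  exact: supp_geX.
by rewrite intS mulrDr mulr1.
Qed.

Lemma supp_ge_inv a x y : supp_ge a x -> x a != 0 -> y * x = 1 -> supp_ge (- a) y.
Proof.
move=> hx xa yx1; have y0 : y != 0.
  by apply: contra_eq_neq yx1 => ->; rewrite mul0r eq_sym oner_eq0.
have [n yn hn] := laurent_ex_ord y0.
have := lead_coefM hn hx; rewrite yx1 lcoef1.
case: (eqVneq (n + a)) => [e _|_ /esym/eqP]; last by rewrite mulf_eq0 (negPf xa) (negPf yn).
by rewrite (_ : - a = n) //; lia.
Qed.

(** A pole hides the constant term: in negative order, [ord_0] reduces to [ord]. *)
Lemma ord_subC n c x : n < 0 -> x n != 0 -> supp_ge n x -> ord (x - c%:L) = n%:E.
Proof.
move=> n0 xn hn; have cn : (c%:L : {laurent f}) n = 0 by rewrite supp_ge_const.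
apply: ordP => [|i ni]; first by rewrite lcoefB cn subr0.
by rewrite lcoefB hn // supp_ge_const ?subr0 //; lia.
Qed.

Lemma lmono_bounded c i : bounded_below (fun j : int => if j == i then c else 0).
Proof. by exists i => j; case: eqVneq => // ->; rewrite ltxx. Qed.

Definition lmono c i : {laurent f} := Laurent (lmono_bounded c i).

Lemma supp_ge_mono c i : supp_ge i (lmono c i).
Proof. by move=> j /=; case: eqVneq => // ->; rewrite ltxx. Qed.

Lemma lmono_mulE c i x n : (lmono c i * x) n = c * x (n - i).
Proof.
rewrite lcoefM -(@fsbig_widen _ _ _ _ [set i]) //; last first.
  by move=> k [_ /= /eqP ki]; rewrite (negPf ki) mul0r.
by rewrite fsbig_set1 /= eqxx.
Qed.

Lemma lmonoM c c' i j : lmono c i * lmono c' j = lmono (c * c') (i + j).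
Proof.
apply/laurentP => n; rewrite lmono_mulE /=.
rewrite (_ : (n - i == j) = (n == i + j)); last by lia.
by case: ifP; rewrite ?mulr0.
Qed.

Lemma lmono0 c : lmono c 0 = c%:L.
Proof. exact/laurentP. Qed.

Lemma lmonoX c i k : lmono c i ^+ k = lmono (c ^+ k) (i * k%:Z).
Proof.
elim: k => [|k IH]; first by rewrite mulr0 !expr0 lmono0.
by rewrite !exprS IH lmonoM intS mulrDr mulr1.
Qed.

Lemma lmono_scale c i : lmono c i = c%:L * lmono 1 i.
Proof. by rewrite -lmono0 lmonoM add0r mulr1. Qed.

Lemma lcoef_constM c x n : (c%:L * x) n = c * x n.
Proof. by rewrite -lmono0 lmono_mulE subr0. Qed.

Lemma lcoef_sum (I : Type) (s : seq I) (G : I -> {laurent f}) n :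
  (\sum_(k <- s) G k) n = \sum_(k <- s) G k n.
Proof. by elim: s => [|k s IH]; rewrite ?big_nil // !big_cons lcoefD IH. Qed.

(** The assumption on [G] is continuity of the coefficient of index [j]: it lets
    [x] be replaced by a finite sum of monomials, to which additivity applies. *)
Lemma additive_support (G : {additive {laurent f} -> {laurent f}}) x j N :
    (forall y, supp_ge N y -> G y j = 0) -> G x j != 0 ->
  exists2 i, x i != 0 & G (lmono (x i) i) j != 0.
Proof.
move=> contG Gxj; have [a ha] := lcoef_bounded x.
(* S is the truncation of x below N. *)
pose e k := a + k%:Z; pose S := \sum_(k < `|N - a|) lmono (x (e k)) (e k).
have hr : supp_ge N (x - S).
  move=> n nN; rewrite lcoefB /S lcoef_sum.
  have [na|an] := ltP n a.
    by rewrite ha // big1 ?subr0 // => k _ /=; rewrite /e ifF //; lia.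
  have lt : (`|n - a| < `|N - a|)%N by lia.
  have en : e (Ordinal lt) = n by rewrite /e /=; lia.
  rewrite (bigD1 (Ordinal lt)) //= en eqxx big1 ?addr0 ?subrr // => k kn.
  rewrite ifF //; apply/negP => /eqP ek; move/eqP: kn; apply; apply: val_inj.
  by move: ek; rewrite /e /=; lia.
have GS : G S j != 0.
  by apply: contra_neq Gxj => GSj; rewrite -(subrK S x) raddfD lcoefD contG // GSj addr0.
apply: contrapT => nex; move/eqP: GS; apply.
rewrite /S raddf_sum lcoef_sum big1 // => k _; apply/eqP/negPn/negP => Gk.
apply: nex; exists (e k) => //; apply: contraNneq Gk => xk.
rewrite xk (_ : lmono 0 _ = 0) ?raddf0 //.
by apply/laurentP => n /=; rewrite if_same.
Qed.

End Order.

(** * The Frobenius map and the Artin-Schreier equation *)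

Section Char.
Variables (f : fieldType) (p : nat).
Hypothesis hp : p \in [pchar f].
Implicit Types (x y z : {laurent f}) (i j a b n : int) (c : f).

Let p_prime : prime p. Proof. exact: pcharf_prime hp. Qed.

Lemma pchar_laurent : p \in [pchar {laurent f}].
Proof.
have lcoefMn k n x : (x *+ k) n = x n *+ k.
  by elim: k => // k IH; rewrite !mulrS lcoefD IH.
rewrite inE p_prime /=; apply/eqP/laurentP => n.
rewrite lcoefMn lcoef1 lcoef0; case: (n == 0); last by rewrite mul0rn.
exact: pcharf0.
Qed.

Lemma frobenius_zmod d : zmod_morphism (fun x => x ^+ (p ^ d)).
Proof.
have D x y : (x + y) ^+ (p ^ d) = x ^+ (p ^ d) + y ^+ (p ^ d).
  rewrite exprDn_pchar // pnatX; apply/orP; left.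
  by rewrite pnatE // pchar_laurent.
by move=> x y; apply: (addIr (y ^+ (p ^ d))); rewrite -D !subrK.
Qed.

Definition frobenius d x := x ^+ (p ^ d).
HB.instance Definition _ d :=
  GRing.isZmodMorphism.Build _ _ (frobenius d) (frobenius_zmod d).

(** Frobenius is additive, continuous, and multiplies exponents of monomials by
    [p ^ d]; so [additive_support] reduces the claim to monomials. *)
Lemma in_laurent_pow_expr d x : in_laurent_pow p d%:Z (x ^+ (p ^ d)).
Proof.
apply/in_laurent_powE => // j xj.
have [y hy|i xi] := @additive_support f (frobenius d) x j `|j|.+1 _ xj.
  apply: (@supp_geX f _ y (p ^ d) hy).
  have : (0 < p ^ d)%N by rewrite expn_gt0 prime_gt0.
  by nia.
rewrite /= /frobenius lmonoX /=; case: ifP => [/eqP -> _|_]; last by rewrite eqxx.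
by rewrite abszM /= dvdn_mull.
Qed.

(** The solution is [z = - (x + x ^ p + x ^ (p ^ 2) + ...)]; the series converges
    because [x ^ (p ^ k)] has order at least [p ^ k]. *)
Lemma artin_schreier x : supp_ge 1 x ->
  exists2 z : {laurent f}, supp_ge 1 z & z ^+ p - z = x.
Proof.
move=> hx.
have hX k : supp_ge (p ^ k)%N%:Z (frobenius k x).
  by have := supp_geX (k := p ^ k) hx; rewrite mul1r.
(* As |n| < p^k for k > |n|, the first |n| + 1 terms determine the coefficient of
   index n. *)
pose zc n := - \sum_(k < `|n|.+1) frobenius k x n.
have zc1 : supp_ge 1 zc.
  move=> n n1; rewrite /zc big1 ?oppr0 // => k _; apply: hX.
  have : (0 < p ^ k)%N by rewrite expn_gt0 prime_gt0.
  by lia.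
have bz : bounded_below zc by exists 1.
pose z := Laurent bz; exists z; first exact: zc1.
apply/laurentP => n.
pose N := `|n|.+1; pose S := \sum_(k < N) frobenius k x.
have widen m K : (`|m| < K)%N ->
    \sum_(k < K) frobenius k x m = \sum_(k < `|m|.+1) frobenius k x m.
  move=> mK; rewrite -!(big_mkord xpredT (fun k => frobenius k x m)).
  rewrite (big_cat_nat (leq0n _) mK) /= [X in _ + X]big_nat_cond [X in _ + X]big1 ?addr0 //.
  move=> k /andP[/andP[mk _] _]; apply: hX.
  by have := ltn_expl k (prime_gt1 p_prime); lia.
have S1 : supp_ge 1 S.
  move=> m m1; rewrite lcoef_sum big1 // => k _; apply: hX.
  have : (0 < p ^ k)%N by rewrite expn_gt0 prime_gt0.
  by lia.
have hr : supp_ge N (z + S).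
  move=> m mN; have [m1|m1] := ltP m 1; first by rewrite lcoefD S1 //= zc1 // addr0.
  by rewrite lcoefD lcoef_sum widen ?addNr //; lia.
(* With z = r - S, where r has order at least N > n, the sum S telescopes. *)
set r := z + S in hr; have -> : z = r - S by rewrite /r addrK.
rewrite -[p]expn1 -/(frobenius 1 (r - S)) raddfB.
have -> : frobenius 1 r - frobenius 1 S - (r - S)
    = frobenius 1 r - r + (S - frobenius 1 S) by ring.
have -> : S - frobenius 1 S = x - frobenius N x.
  rewrite /S raddf_sum /=.
  rewrite -(big_mkord xpredT (fun k => frobenius k x)).
  rewrite -(big_mkord xpredT (fun k => frobenius 1 (frobenius k x))).
  under [X in _ - X]eq_bigr => k _ do
    rewrite /frobenius -exprM -expnD addn1 -/(frobenius k.+1 x).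
  rewrite -opprB -sumrB (telescope_sumr_eq (fun k => frobenius k x)) //.
  by rewrite opprB /frobenius expn0 expr1.
rewrite !lcoefD !lcoefN.
rewrite hX; last by have := ltn_expl N (prime_gt1 p_prime); lia.
rewrite (_ : frobenius 1 r n = 0); last first.
  have := supp_geX (k := p ^ 1) hr; apply; have := prime_gt1 p_prime.
  by rewrite expn1; nia.
by rewrite hr ?subr0 ?addr0 ?add0r //; lia.
Qed.

(** * Automorphisms over the constants preserve the order *)

Section Endomorphism.
Variable g : {rmorphism {laurent f} -> {laurent f}}.
Hypothesis gC : forall c, g c%:L = c%:L.

(** Artin-Schreier descent. If [g x] has order [- k.+1] and [x = z ^ p - z], then the
    order of [g z] is negative too, the leading term of [(g z) ^ p] cannot cancel, and
    [- k.+1] is [p] times the order of [g z]. So [g z] has a pole of strictly smaller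
    order than [g x], and the same applies to [z]. *)
Lemma endo_maximal_to_integers x : supp_ge 1 x -> supp_ge 0 (g x).
Proof.
move=> hx; have [-> i _ //|gx0] := eqVneq (g x) 0.
have [n gxn hn] := laurent_ex_ord gx0.
have [|n0] := leP 0 n; first by move/supp_ge_le; apply.
exfalso; have [k ek] : exists k : nat, n = - k.+1%:Z by exists `|n|.-1; lia.
move: gxn hn hx {gx0 n0}; rewrite {n}ek.
elim/ltn_ind: k x => k IH x gxk hk hx.
have [z hz ez] := artin_schreier hx.
have egz : g z ^+ p - g z = g x by rewrite -ez rmorphB rmorphXn.
have gz0 : g z != 0.
  apply: contraNneq gxk => gz0.
  by rewrite -egz gz0 subr0 expr0n (gtn_eqF (prime_gt0 p_prime)).
have [n gzn hn] := laurent_ex_ord gz0.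
have p1 := prime_gt1 p_prime.
have hpn := supp_geX (k := p) hn; have epn := lead_coefX p hn.
have [n0|n0] := leP 0 n.
  move/eqP: gxk; apply; rewrite -egz lcoefB hn ?hpn ?subr0 //;
  by have := mulr_ge0 n0 (isT : 0 <= p%:Z); lia.
have npn : n * p%:Z <= n * 2 by rewrite ler_nM2l //; lia.
have gxpn : g x (n * p%:Z) != 0.
  by rewrite -egz lcoefB epn (hn (n * p%:Z)) ?subr0 ?expf_neq0 //; lia.
have [kn|//] : - k.+1%:Z <= n * p%:Z \/ n * p%:Z < - k.+1%:Z by lia.
  apply: (IH `|n|.-1 _ z) => //=; first by lia.
    by rewrite (_ : - _ = n) //; lia.
  by rewrite (_ : - _ = n) //; lia.
by move=> /hk e; rewrite e eqxx in gxpn.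
Qed.

Lemma endo_integers x : supp_ge 0 x -> supp_ge 0 (g x).
Proof.
move=> hx; rewrite -(subrK (x 0)%:L x) rmorphD gC.
apply: supp_geD; last exact: supp_ge_const.
exact/endo_maximal_to_integers/supp_ge_sub_const.
Qed.

(** If [g x] had a nonzero constant term [c], then [x - c] would be a unit of the
    valuation ring, while its image [g x - c] has positive order. *)
Lemma endo_maximal x : supp_ge 1 x -> supp_ge 1 (g x).
Proof.
move=> hx; have gx := endo_maximal_to_integers hx.
have [e|c0] := eqVneq (g x 0) 0; first by rewrite -[1]add0r; exact: supp_geS.
have hu : supp_ge 0 (x - (g x 0)%:L).
  by apply: supp_geB; [exact: supp_ge_le hx|exact: supp_ge_const].
have u0 : (x - (g x 0)%:L) 0 != 0 by rewrite lcoefB hx //= sub0r oppr_eq0.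
have nzu : x - (g x 0)%:L != 0 by apply: contraNneq u0 => ->.
have yu := mulVf nzu.
have := supp_ge_inv hu u0 yu; rewrite oppr0 => /endo_integers gy.
have gu : supp_ge 1 (g (x - (g x 0)%:L)).
  by rewrite rmorphB gC; exact: supp_ge_sub_const.
have := supp_geM gy gu; rewrite -rmorphM yu rmorph1 add0r => /(_ 0 isT).
by rewrite lcoef1 eqxx => /eqP; rewrite oner_eq0.
Qed.

End Endomorphism.

Section Automorphism.
Variables g g' : {rmorphism {laurent f} -> {laurent f}}.
Hypothesis gC : forall c, g c%:L = c%:L.
Hypothesis g'C : forall c, g' c%:L = c%:L.
Hypothesis gK : cancel g g'.

Let t := lmono (1 : f) 1.

(** If [g t] had order at least 2, then [g t / t] would have positive order, so
    [t = g' (g t / t) * g' t] would be a product of two elements of positive order. *)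
Lemma auto_uniformizer : g t 1 != 0.
Proof.
have ht : supp_ge 1 t by exact: supp_ge_mono.
apply/eqP => e; have : supp_ge 2 (g t).
  by rewrite -[2]/(1 + 1); apply: supp_geS => //; exact: endo_maximal.
move=> gt2; have := supp_geM gt2 (@supp_ge_mono f 1 (-1)).
move=> /(endo_maximal g'C); rewrite rmorphM gK => h1.
have := supp_geM h1 (endo_maximal g'C ht).
rewrite -mulrA -rmorphM lmonoM mulr1 lmono0 g'C mulr1 => /(_ 1 isT).
by move=> /eqP; rewrite oner_eq0.
Qed.

(** Factoring out [t ^ n] reduces to elements of the valuation ring; for [n < 0] the
    order of [g (t ^ n)] is controlled because that of [g t] is exactly 1. *)
Lemma auto_supp_ge n x : supp_ge n x -> supp_ge n (g x).
Proof.
move=> hx.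
have ht : supp_ge 1 (g t) by apply/endo_maximal/supp_ge_mono.
have hX k : supp_ge k%:Z (g (lmono 1 k%:Z)).
  have := supp_geX (k := k) ht; rewrite -rmorphXn lmonoX expr1n.
  by rewrite mul1r.
have htn : supp_ge n (g (lmono 1 n)).
  have [n0|n0] := leP 0 n; first by have := hX `|n|%N; rewrite (_ : `|n|%N%:Z = n) //; lia.
  have en : - `|n|%N%:Z = n by lia.
  rewrite -{1}en; apply: (@supp_ge_inv _ _ (g (lmono 1 `|n|%N%:Z))) => //.
    have := lead_coefX `|n|%N ht; rewrite -rmorphXn lmonoX expr1n mul1r => ->.
    exact/expf_neq0/auto_uniformizer.
  by rewrite -rmorphM lmonoM mulr1 (_ : n + _ = 0) ?lmono0 ?rmorph1 //; lia.
have ex : lmono 1 n * (lmono 1 (- n) * x) = x.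
  by rewrite mulrA lmonoM mulr1 subrr lmono0 mul1r.
have hu : supp_ge 0 (g (lmono 1 (- n) * x)).
  apply: (endo_integers gC).
  by have := supp_geM (@supp_ge_mono f 1 (- n)) hx; rewrite addNr.
by have := supp_geM htn hu; rewrite addr0 -rmorphM ex.
Qed.

(** An exponent [p ^ d * l] gives the monomial [c * (t ^ l) ^ (p ^ d)], whose image
    [c * (g (t ^ l)) ^ (p ^ d)] is again supported on multiples of [p ^ d]; the
    coefficient [c] stays outside the power because [g] fixes it. *)
Lemma auto_in_pow (m : int) x : in_laurent_pow p m x -> in_laurent_pow p m (g x).
Proof.
(* For m < 0 the condition is void, since p^(-m) is an integer. *)
case: m => [d|d]; last by move=> _ i _; rewrite NegzE; apply: int_div_expN.
move=> /(in_laurent_powE p_prime) hx; apply/(in_laurent_powE p_prime) => j gxj.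
have [y hy|i xi] := @additive_support f g x j (j + 1) _ gxj.
  by apply: (auto_supp_ge hy); lia.
have /dvdzP[l ->] : ((p ^ d)%N%:Z %| i)%Z := hx _ xi.
set c := x _.
have -> : lmono c (l * (p ^ d)%N%:Z) = c%:L * lmono 1 l ^+ (p ^ d).
  by rewrite lmonoX expr1n -lmono_scale.
rewrite /= rmorphM gC rmorphXn lcoef_constM.
rewrite mulf_eq0 negb_or => /andP[_].
have := @in_laurent_pow_expr d (g (lmono 1 l)).
by move=> /(in_laurent_powE p_prime); apply.
Qed.

End Automorphism.

(** * Invariance of the width *)

Section Invariance.
Variables g g' : {rmorphism {laurent f} -> {laurent f}}.
Hypothesis gC : forall c, g c%:L = c%:L.
Hypothesis g'C : forall c, g' c%:L = c%:L.
Hypothesis gK : cancel g g'.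
Hypothesis g'K : cancel g' g.

Lemma auto_lead_coef n x : supp_ge n x -> x n != 0 -> g x n != 0.
Proof.
move=> hx xn; apply: contra_neq xn => gxn.
have gx := auto_supp_ge gC g'C gK hx.
have := auto_supp_ge g'C gC g'K (supp_geS gx gxn).
by rewrite gK => /(_ n); apply; lia.
Qed.

Lemma auto_ord x : ord (g x) = ord x.
Proof.
have [->|x0] := eqVneq x 0; first by rewrite rmorph0.
have [n xn hn] := laurent_ex_ord x0.
by rewrite (ordP xn hn) (ordP (auto_lead_coef hn xn) (auto_supp_ge gC g'C gK hn)).
Qed.

Lemma auto_in_powE (m : int) x : in_laurent_pow p m (g x) <-> in_laurent_pow p m x.
Proof.
split; last exact: (auto_in_pow gC g'C gK).
by move=> /(auto_in_pow g'C gC g'K); rewrite gK.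
Qed.

Lemma auto_md h : md p (g h) = md p h.
Proof.
rewrite /md.
suff -> : [set m | in_laurent_pow p m (g h)] = [set m | in_laurent_pow p m h] by [].
by apply/predeqP => m; exact: auto_in_powE.
Qed.

Lemma auto_ord_md h : ord_md p (g h) = ord_md p h.
Proof.
rewrite /ord_md auto_md; case: (md p h) => // d.
suff -> : [set ord (g h - a) | a in [set a | in_laurent_pow p (d + 1) a]]
  = [set ord (h - a) | a in [set a | in_laurent_pow p (d + 1) a]] by [].
apply/seteqP; split=> _ [a /= ha <-].
  exists (g' a) => /=; first by apply/auto_in_powE; rewrite g'K.
  by rewrite -auto_ord rmorphB g'K.
exists (g a) => /=; first exact/auto_in_powE.
by rewrite -rmorphB auto_ord.
Qed.

(** [h - x_0(h)] is not [g]-equivariant on the nose: when [h] has a pole, [g] may change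
    the constant term, but then this term does not affect the order. *)
Lemma auto_ord_0 h : ord_0 (g h) = ord_0 h.
Proof.
rewrite /ord_0; have [->|h0] := eqVneq h 0; first by rewrite rmorph0.
have [n hn ltn] := laurent_ex_ord h0.
have [n0|n0] := leP 0 n; last first.
  by rewrite !(@ord_subC f n) //; [exact: auto_lead_coef|exact: (auto_supp_ge gC g'C gK)].
suff -> : g h 0 = h 0 by rewrite -[(h 0)%:L in LHS]gC -rmorphB auto_ord.
have := supp_ge_sub_const (supp_ge_le n0 ltn).
move=> /(endo_maximal gC)/(_ 0 isT)/eqP.
by rewrite rmorphB gC lcoefB /= subr_eq0 => /eqP.
Qed.

(** On monomials, [g] only moves exponents up, and to exponents that are at least as
    divisible by [p]; both effects lower the fractions that define the width. *)
Lemma auto_width_le h : width p (g h) <= width p h.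
Proof.
have [[c ->]|nc] := pselect (exists c, h = c%:L); first by rewrite gC.
have hc c : h <> c%:L by move=> e; apply: nc; exists c.
have [d [mdh _ _]] := md_attained p_prime hc.
have [n [omd hn nd low]] := ord_md_attained p_prime mdh hc.
have [lt|ge] := boolP (ord_0 h < n%:E)%E; last first.
  by rewrite /width auto_ord_0 auto_ord_md omd (negPf ge).
have omd' : ord_md p (g h) = n%:E by rewrite auto_ord_md.
have lt' : (ord_0 (g h) < n%:E)%E by rewrite auto_ord_0.
have [j [gj j0 jn -> _]] := width_attained p_prime omd' lt'.
have [y hy|i hi gij] := @additive_support f g h j (j + 1) _ gj.
  by apply: (auto_supp_ge gC g'C gK hy); lia.
have [k [_ _ _ _ mx]] := width_attained p_prime omd lt.
have ij : i <= j.
  rewrite leNgt; apply: contraNN gij => ji.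
  by rewrite (auto_supp_ge gC g'C gK (@supp_ge_mono f _ _)).
pose e := logn p `|i|.
have pej : (p ^ e %| `|j|)%N.
  apply: (proj1 (in_laurent_powE p_prime e _) _ _ gij); apply: (auto_in_pow gC g'C gK).
  apply/(in_laurent_powE p_prime) => l /=; case: ifP => [/eqP -> _|_]; last by rewrite eqxx.
  exact: pfactor_dvdnn.
have i0 : i != 0.
  by apply: contraNneq gij => ->; rewrite /= lmono0 gC /= (negPf j0).
apply: le_trans (mx i hi i0 (le_lt_trans ij jn)).
have n0 : n != 0 by apply: contraNneq nd => ->; rewrite dvdn0.
have lej : (e <= logn p `|j|)%N by rewrite -pfactor_dvdn // absz_gt0.
(* Both denominators are positive: p ^ d.+1 divides i but not n. *)
have lei : (logn p `|n| < e)%N.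
  have : (d < e)%N.
    by rewrite -pfactor_dvdn ?absz_gt0 // low // (le_lt_trans ij jn).
  by apply: leq_ltn_trans; rewrite leqNgt -pfactor_dvdn ?absz_gt0.
rewrite !padic_abs_invE // -/e; apply: le_floor.
have p1 := prime_gt1 p_prime.
have lt_pow u v : (u < v)%N -> ((p ^ u)%N%:Q < (p ^ v)%N%:Q)%R.
  by move=> uv; rewrite ltr_int ltz_nat ltn_exp2l.
have le_pow u v : (u <= v)%N -> ((p ^ u)%N%:Q <= (p ^ v)%N%:Q)%R.
  by move=> uv; rewrite ler_int lez_nat leq_exp2l.
apply: ler_pM; rewrite ?invr_ge0 ?subr_ge0.
- by rewrite ler0z; lia.
- exact/le_pow/ltnW/(leq_trans lei).
- by rewrite ler_int; lia.
rewrite lef_pV2 ?posrE ?subr_gt0 ?lerB ?le_pow ?lt_pow //.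
exact: leq_trans lej.
Qed.

End Invariance.

End Char.

Lemma G0_inverse (f : fieldType) (g : {rmorphism {laurent f} -> {laurent f}}) :
  G0 f g -> exists2 g' : {rmorphism {laurent f} -> {laurent f}},
    cancel g g' /\ cancel g' g & forall c, g' c%:L = c%:L.
Proof.
move=> [[g' gK g'K] gC].
pose g'A := GRing.isZmodMorphism.Build _ _ g' (can2_zmod_morphism gK g'K).
pose g'M := GRing.isMonoidMorphism.Build _ _ g' (can2_monoid_morphism gK g'K).
pose G : {rmorphism {laurent f} -> {laurent f}} := HB.pack g' g'A g'M.
by exists G => // c; rewrite -[in LHS]gC /= gK.
Qed.

Theorem proposition1 (f : fieldType) (p : nat) (hp : p \in [pchar f])
    (g : {rmorphism {laurent f} -> {laurent f}}) (hg : G0 f g)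
    (h : {laurent f}) :
  width p (g h) = width p h.
Proof.
have [g' [gK g'K] g'C] := G0_inverse hg; have [_ gC] := hg.
apply/le_anti/andP; split; first exact: (auto_width_le hp gC g'C gK g'K).
by rewrite -{1}(gK h); apply: (auto_width_le hp g'C gC g'K gK).
Qed.
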